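(* Let $n\ge2$. Define on $\mathscr{C}_n$ the $n$-ary operation $$(f_1,\dots,f_n)\lambda = f_1\rho_{a_1}^{-1}\cup\dots\cup f_n\rho_{a_n}^{-1}$$ and the $n$ unary operations $(f)\alpha_i=f\rho_{a_i}$ for $1\le i\le n$. Then $(\mathscr{C}_n,\alpha_1,\dots,\alpha_n,\lambda)$ is an $n$-ary Cantor algebra.
   Context: An $n$-ary Cantor algebra is a structure $(X,\alpha_1,\dots,\alpha_n,\lambda)$, where the $\alpha_i$ are unary operations and $\lambda$ is an $n$-ary operation on $X$ (operations written to the right of their arguments), satisfying: (CA1) $(x\alpha_1,\dots,x\alpha_n)\lambda=x$ for all $x\in X$; (CA2) $(x_1,\dots,x_n)\lambda\alpha_i=x_i$ for all $x_1,\dots,x_n\in X$ and $1\le i\le n$. $A_n=\{a_1,\dots,a_n\}$, $n\geq 2$; $A_n^{*}$ is the free monoid, $A_n^{\omega}$ the Cantor space of right-infinite strings. A finite subset of $A_n^{*}$ is a prefix code if no element is a prefix of a different element ($\varnothing$ is allowed). A morphism $\theta:R_1\to R_2$ between right ideals of $A_n^{*}$ is a function with $\theta(rs)=\theta(r)s$. $M_n$ is the monoid (under composition of partial functions) of all surjective morphisms between finitely generated right ideals of $A_n^{*}$, together with the empty function. For $f,g\in M_n$, $f\le g$ means that $f$ is a restriction of $g$. The congruence $\equiv$ on $M_n$ is: $f\equiv g$ iff for every $0<x\le f$ there is a non-zero element below both $x$ and $g$, and for every $0<y\le g$ there is a non-zero element below both $y$ and $f$. $\mathscr{C}_n=M_n/{\equiv}$.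 Each $f\in M_n$ can be written uniquely as $f=\bigcup_{i=1}^{m}y_ix_i^{-1}$ with $X=\{x_1,\dots,x_m\}$ a prefix code and $y_i\in A_n^{*}$, where $y_ix_i^{-1}$ is the map $x_iu\mapsto y_iu$. It induces the partial function on $A_n^{\omega}$ with domain $XA_n^{\omega}$ given by $x_iw\mapsto y_iw$ ($w\in A_n^{\omega}$). Two elements of $M_n$ are $\equiv$-related iff they induce the same partial function on $A_n^{\omega}$, and in this way the elements of $\mathscr{C}_n$ are regarded as partial functions on $A_n^{\omega}$ (surjective local homeomorphisms between clopen subsets), multiplied by composition of partial functions. For $a\in A_n$, $\rho_a:A_n^{\omega}\to aA_n^{\omega}$ is the homeomorphism $w\mapsto aw$, and $\rho_a^{-1}:aA_n^{\omega}\to A_n^{\omega}$ is its inverse. Products such as $f\rho_a$ are composites of partial functions with the right-hand factor applied first. *)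

(* Defs.v *)
From HB Require Import structures.
From mathcomp Require Import all_boot.
From mathcomp Require Import mathcomp_extra boolp classical_sets.

Set Implicit Arguments.
Unset Strict Implicit.
Unset Printing Implicit Defensive.

Local Open Scope classical_set_scope.
Local Open Scope quotient_scope.

(** Partial functions are represented by their graphs, so that restriction is
    [`<=`] and the union of partial functions is the union of graphs. *)

Definition functional (T U : Type) (f : set (T * U)) : Prop :=
  forall x y z, f (x, y) -> f (x, z) -> y = z.

(* The right-hand factor is applied first. *)
Definition comp_graph (T U V : Type) (f : set (U * V)) (g : set (T * U)) :
    set (T * V) :=
  [set xz | exists y, g (xz.1, y) /\ f (y, xz.2)].

Definition inv_graph (T U : Type) (f : set (T * U)) : set (U * T) :=
  [set yx | f (yx.2, yx.1)].

(** The alphabet [A_n] is ['I_n]. *)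

Definition word (n : nat) : Type := seq 'I_n.
Definition omega (n : nat) : Type := nat -> 'I_n.

Definition wcat (n : nat) (x : word n) (w : omega n) : omega n :=
  fun k => nth (w (k - size x)) x k.

Definition prefix_code (n : nat) (X : seq (seq 'I_n)) : Prop :=
  {in X &, forall x y, prefix x y -> x = y}.

Definition right_ideal (n : nat) (R : set (word n)) : Prop :=
  forall r s, R r -> R (r ++ s).

Definition fg_right_ideal (n : nat) (R : set (word n)) : Prop :=
  right_ideal R /\
  exists G : seq (seq 'I_n), R = [set u | exists g s, g \in G /\ u = g ++ s].

Definition surjective_morphism (n : nat) (R1 R2 : set (word n))
    (f : set (word n * word n)) : Prop :=
  [/\ functional f, f.`1 = R1, f.`2 = R2 &
      forall r t s, f (r, t) -> f (r ++ s, t ++ s)].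

Definition in_M (n : nat) (f : set (word n * word n)) : Prop :=
  f = set0 \/
  exists R1 R2, [/\ fg_right_ideal R1, fg_right_ideal R2 &
                    surjective_morphism R1 R2 f].

Record M (n : nat) : Type :=
  MkM { graph : set (word n * word n); graphP : in_M graph }.

HB.instance Definition _ (n : nat) := gen_eqMixin (M n).
HB.instance Definition _ (n : nat) := gen_choiceMixin (M n).

Definition M_le (n : nat) (f g : M n) : Prop := graph f `<=` graph g.

Definition M_nonzero (n : nat) (f : M n) : Prop := graph f <> set0.

Definition M_equiv (n : nat) (f g : M n) : Prop :=
  (forall x, M_nonzero x -> M_le x f ->
     exists z, [/\ M_nonzero z, M_le z x & M_le z g]) /\
  (forall y, M_nonzero y -> M_le y g ->
     exists z, [/\ M_nonzero z, M_le z y & M_le z f]).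

Definition M_equivb (n : nat) : rel (M n) := fun f g => `[< M_equiv f g >].

Lemma M_equivb_refl n : reflexive (@M_equivb n).
Proof. by move=> f; apply/asboolP; split=> x x0 xf; exists x; split. Qed.

Lemma M_equivb_sym n : symmetric (@M_equivb n).
Proof. by move=> f g; apply/asboolP/asboolP => -[fg gf]; split. Qed.

Lemma M_equivb_trans n : transitive (@M_equivb n).
Proof.
move=> g f h /asboolP[fg gf] /asboolP[gh hg]; apply/asboolP; split.
- move=> x x0 /(fg x x0)[y [y0 yx /(gh y y0)[z [z0 zy zh]]]].
  by exists z; split=> //; apply: subset_trans zy yx.
- move=> x x0 /(hg x x0)[y [y0 yx /(gf y y0)[z [z0 zy zh]]]].
  by exists z; split=> //; apply: subset_trans zy yx.
Qed.

Canonical M_equiv_rel n : equiv_rel (M n) :=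
  EquivRel (@M_equivb n)
    (@M_equivb_refl n) (@M_equivb_sym n) (@M_equivb_trans n).

Definition Cn (n : nat) : Type := {eq_quot (M_equiv_rel n)}.

(* [c] lists the pairs [(x_i, y_i)] of an expression of [f] as the union of the
   maps [y_i x_i^-1], the [x_i] being distinct and forming a prefix code. *)
Definition code_form (n : nat) (c : seq (seq 'I_n * seq 'I_n))
    (f : set (word n * word n)) : Prop :=
  [/\ uniq (map fst c), prefix_code (map fst c) &
      f = [set uv | exists x y s,
                      (x, y) \in c /\ uv = (x ++ s, y ++ s)]].

Definition induced (n : nat) (f : M n) : set (omega n * omega n) :=
  [set uv | exists c, code_form c (graph f) /\
              exists x y w, (x, y) \in c /\ uv = (wcat x w, wcat y w)].

(* The partial function on infinite strings with which an element of [Cn n] is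
   identified; see [pfun_pi] and [pfun_inj] below. *)
Definition pfun (n : nat) (c : Cn n) : set (omega n * omega n) :=
  induced (repr c).

Definition rho (n : nat) (a : 'I_n) : set (omega n * omega n) :=
  [set uv | uv.2 = wcat [:: a] uv.1].

Definition cantor_algebra (n : nat) (X : Type)
    (alpha : 'I_n -> X -> X) (lambda : ('I_n -> X) -> X) : Prop :=
  (forall x, lambda (fun i => alpha i x) = x) /\
  (forall (xs : 'I_n -> X) (i : 'I_n), alpha i (lambda xs) = xs i).

(** Two elements of [M n] are equivalent iff they induce the same partial
    function. *)

Lemma wcatA n (x y : word n) (w : omega n) :
  wcat (x ++ y) w = wcat x (wcat y w).
Proof.
apply/funext => k; rewrite /wcat size_cat nth_cat.
case: ltnP => kx; first exact: set_nth_default.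
by rewrite (nth_default _ kx) subnDA.
Qed.

Lemma wcat_mkseq n (w : omega n) k :
  wcat (mkseq w k) (fun i => w (k + i)) = w.
Proof.
apply/funext => i; rewrite /wcat size_mkseq.
have [ik|ki] := ltnP i k; first by rewrite nth_mkseq.
by rewrite nth_default ?size_mkseq// subnKC.
Qed.

Lemma wcat_inj n (x : word n) : injective (wcat x).
Proof.
move=> v w /(congr1 (fun u k => u (size x + k))) e; apply/funext => k.
have := congr1 (@^~ k) e.
by rewrite /wcat /= !nth_default ?leq_addr// addKn.
Qed.

Lemma wcat_prefix n (x y : word n) (v w : omega n) : wcat x v = wcat y w ->
  size x <= size y -> exists2 s, y = x ++ s & v = wcat s w.
Proof.
move=> e xy; have y_x : take (size x) y = x.
  apply: (@eq_from_nth _ (v 0)); first by rewrite size_takel.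
  rewrite size_takel// => i ix; rewrite nth_take//.
  have := congr1 (@^~ i) e; rewrite /wcat.
  have iy := leq_trans ix xy.
  by rewrite (set_nth_default (v 0) _ ix) (set_nth_default (v 0) _ iy).
have yE : y = x ++ drop (size x) y by rewrite -{1}y_x cat_take_drop.
exists (drop (size x) y) => //.
by apply: (@wcat_inj _ x); rewrite e -wcatA -yE.
Qed.

Lemma wcat_id n (v : word n) : 1 < n -> (forall w, wcat v w = w) -> v = [::].
Proof.
case: n v => [//|[//|n]] [//|a v] _ h.
pose b : 'I_n.+2 := if a == ord0 then ord_max else ord0.
have := congr1 (@^~ 0) (h (fun=> b)); rewrite /wcat /= => ab.
by move: ab; rewrite /b; have [->|/eqP] := eqVneq a ord0.
Qed.

Lemma wcat_injl n (x y : word n) : 1 < n ->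
  (forall w, wcat x w = wcat y w) -> x = y.
Proof.
move=> n1; wlog xy : x y / size x <= size y.
  move=> H e; have [xy|/ltnW yx] := leqP (size x) (size y); first exact: H.
  by apply/esym; apply: H => // w; rewrite e.
move=> e.
have [s ys _] := wcat_prefix (e (fun=> Ordinal (ltnW n1))) xy.
suff s0 : s = [::] by rewrite ys s0 cats0.
by apply: wcat_id => // w; apply: (@wcat_inj _ x); rewrite -wcatA -ys e.
Qed.

Lemma graph_functional n (f : M n) : functional (graph f).
Proof. by case: f => f /= [->//|[R1 [R2 [_ _ []]]]]. Qed.

Lemma graph_cat n (f : M n) r t s :
  graph f (r, t) -> graph f (r ++ s, t ++ s).
Proof. by case: f => f /= [->//|[R1 [R2 [_ _ [_ _ _]]]]]; apply. Qed.

Lemma graph_dom n (f : M n) : exists G : seq (seq 'I_n),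
  (graph f).`1 = [set u | exists g s, g \in G /\ u = g ++ s].
Proof.
case: f => f /= [->|[R1 [R2 [[_ [G R1E]] _ [_ fE _ _]]]]]; last first.
  by exists G; rewrite fE.
by exists [::]; apply/seteqP; split=> [x []//|x /= [? [? []]]].
Qed.

Lemma code_formP n (f : M n) : exists c, code_form c (graph f).
Proof.
have [G fG] := graph_dom f.
have fGx x : x \in G -> exists y, graph f (x, y).
  move=> xG; suff: (graph f).`1 x by [].
  by rewrite fG; exists x, [::]; rewrite cats0.
pose F x : word n := xget [::] [set y | graph f (x, y)].
have FP x : x \in G -> graph f (x, F x).
  by move=> /fGx[y fxy]; rewrite /F; case: xgetP => [z _|/(_ y)].
pose X := undup [seq x <- G | all (fun g => prefix g x ==> (g == x)) G].
have XG x : x \in X -> x \in G by rewrite mem_undup mem_filter => /andP[].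
have GX g : g \in G -> exists2 x, x \in X & prefix x g.
  move: {-1}(size g) (leqnn (size g)) => m.
  elim: m g => [|m IH] g gm gG.
    move: gm; rewrite leqn0 size_eq0 => /eqP g0; subst g.
    exists [::]; last by [].
    rewrite mem_undup mem_filter gG andbT; apply/allP => h _.
    by rewrite prefixs0; apply/implyP.
  have [/allP gmin|/allPn[h hG]] :=
      boolP (all (fun h => prefix h g ==> (h == g)) G).
    exists g; last exact: prefix_refl.
    by rewrite mem_undup mem_filter gG andbT; apply/allP.
  rewrite negb_imply => /andP[hg hNg].
  have hm : size h <= m.
    rewrite -ltnS; apply: leq_trans gm; rewrite ltn_neqAle size_prefix// andbT.
    apply: contraNN hNg => /eqP hs.
    by move: hg; rewrite prefixE hs take_size eq_sym.
  have [x xX xh] := IH h hm hG.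
  by exists x => //; apply: prefix_trans xh hg.
exists [seq (x, F x) | x <- X].
have X1 : map fst [seq (x, F x) | x <- X] = X.
  by rewrite -map_comp -[RHS]map_id; apply: eq_map.
rewrite /code_form X1; split; first exact: undup_uniq.
  move=> x y xX; rewrite mem_undup mem_filter => /andP[/allP ymin yG] xy.
  by have /implyP/(_ xy)/eqP := ymin x (XG _ xX).
apply/seteqP; split=> [[u v] fuv|_ [x [y [s [/mapP[z zX [-> ->]] ->]]]]].
  have: (graph f).`1 u by exists v.
  rewrite fG => -[g [s [gG ug]]].
  have [x xX /prefixP[t gt]] := GX g gG.
  exists x, (F x), (t ++ s); split; first by apply/mapP; exists x.
  have ux : u = x ++ t ++ s by rewrite ug gt catA.
  rewrite -ux; congr pair; apply: (graph_functional fuv).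
  by rewrite ux; apply: graph_cat; apply: FP; apply: XG.
by apply: graph_cat; apply: FP; apply: XG.
Qed.

Lemma induced_graph n (f : M n) u v : induced f (u, v) <->
  exists x y w, graph f (x, y) /\ (u, v) = (wcat x w, wcat y w).
Proof.
split=> [[c [[_ _ fE] [x [y [w [xyc uv]]]]]]|[x [y [w [fxy [-> ->]]]]]].
  exists x, y, w; split=> //; rewrite fE.
  by exists x, y, [::]; rewrite !cats0.
have [c cf] := code_formP f; exists c; split=> //.
case: cf => _ _ fE; move: fxy; rewrite fE => -[x' [y' [s [xyc [-> ->]]]]].
by exists x', y', (wcat s w); rewrite !wcatA.
Qed.

Lemma cone_in_M n (r t : word n) :
  in_M [set uv | exists s : word n, uv = (r ++ s, t ++ s)].
Proof.
have fgc (x : word n) : fg_right_ideal [set u | exists s : word n, u = x ++ s].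
  split; first by move=> _ s [s' ->]; exists (s' ++ s); rewrite catA.
  exists [:: x]; apply/seteqP; split=> [_ [s ->]|_ [g [s [+ ->]]]].
    by exists x, s; rewrite inE eqxx.
  by rewrite inE => /eqP ->; exists s.
right; exists [set u | exists s : word n, u = r ++ s],
  [set u | exists s : word n, u = t ++ s]; split=> //; split.
- move=> x y z [s [-> ->]] [s' [/eqP + ->]].
  by rewrite eqseq_cat// eqxx => /eqP ->.
- apply/seteqP; split=> [x [y [s [-> _]]]|_ [s ->]]; first by exists s.
  by exists (t ++ s), s.
- apply/seteqP; split=> [x [y [s [_ ->]]]|_ [s ->]]; first by exists s.
  by exists (r ++ s), s.
- by move=> x y s [s' [-> ->]]; exists (s' ++ s); rewrite !catA.
Qed.

Definition cone n (r t : word n) : M n := MkM (cone_in_M r t).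

Lemma cone_neq0 n (r t : word n) : M_nonzero (cone r t).
Proof.
move=> e; have : graph (cone r t) (r, t) by exists [::]; rewrite !cats0.
by rewrite e.
Qed.

Lemma cone_le n (r t : word n) (f : M n) :
  graph f (r, t) -> M_le (cone r t) f.
Proof. by move=> frt _ [s ->]; apply: graph_cat. Qed.

Lemma M_nonzeroP n (f : M n) :
  M_nonzero f <-> exists r t, graph f (r, t).
Proof.
split=> [/eqP/set0P[[r t] frt]|[r [t frt]] f0]; first by exists r, t.
by move: frt; rewrite f0.
Qed.

Lemma M_equivP n (f g : M n) : 1 < n ->
  M_equiv f g <-> induced f = induced g.
Proof.
move=> n1; split.
  suff H (f1 g1 : M n) : (forall x, M_nonzero x -> M_le x f1 ->
      exists z, [/\ M_nonzero z, M_le z x & M_le z g1]) ->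
      induced f1 `<=` induced g1.
    by move=> [fg gf]; apply/seteqP; split; apply: H.
  move=> fg [u v] /induced_graph[x [y [w [fxy [-> ->]]]]].
  have [c [_ _ gE]] := code_formP g1.
  pose k := \max_(p <- c) size p.1.
  have fk := graph_cat (mkseq w k) fxy.
  have [z [/M_nonzeroP[r [t zrt]] zf zg]] :=
    fg _ (@cone_neq0 _ _ _) (cone_le fk).
  have [s [rE tE]] := zf _ zrt.
  have := zg _ zrt; rewrite gE => -[x' [y' [s' [xyc [rE' tE']]]]].
  have gxy' : graph g1 (x', y').
    by rewrite gE; exists x', y', [::]; rewrite !cats0.
  have /prefixP[q qE] : prefix x' (x ++ mkseq w k).
    rewrite prefixE; apply/eqP.
    have xk : size x' <= size (x ++ mkseq w k).
      rewrite size_cat size_mkseq; apply: leq_trans (leq_addl _ _).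
      by rewrite /k (big_rem _ xyc) /= leq_maxl.
    have := congr1 (take (size x')) (etrans (esym rE) rE').
    by rewrite (takel_cat _ xk) (take_size_cat _ erefl).
  have s'E : s' = q ++ s.
    have /eqP := etrans (esym rE) rE'.
    by rewrite qE -catA eqseq_cat// eqxx => /eqP ->.
  have yq : y ++ mkseq w k = y' ++ q.
    have /eqP := etrans (esym tE) tE'.
    have e : size (y ++ mkseq w k) = size (y' ++ q).
      have := congr1 size (etrans (esym tE) tE').
      by rewrite s'E !size_cat !addnA => /addIn.
    by rewrite s'E (catA y') eqseq_cat// => /andP[/eqP].
  apply/induced_graph; exists x', y', (wcat q (fun i => w (k + i))).
  by split=> //; rewrite -!wcatA -yq -qE !wcatA wcat_mkseq.
suff H (f1 g1 : M n) : induced f1 `<=` induced g1 ->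
    forall x, M_nonzero x -> M_le x f1 ->
      exists z, [/\ M_nonzero z, M_le z x & M_le z g1].
  by move=> e; split; apply: H; rewrite e.
move=> fg x /M_nonzeroP[r [t xrt]] xf.
pose w0 : omega n := fun=> Ordinal (ltnW n1).
have /fg/induced_graph[x' [y' [w [gxy' [rE _]]]]] :
    induced f1 (wcat r w0, wcat t w0).
  by apply/induced_graph; exists r, t, w0; split=> //; apply: xf.
pose s := mkseq w0 (size x').
have : wcat x' w = wcat (r ++ s) (fun i => w0 (size x' + i)).
  by rewrite wcatA wcat_mkseq.
case/wcat_prefix=> [|q rsE _].
  by rewrite size_cat size_mkseq leq_addl.
have grs : graph g1 (r ++ s, y' ++ q) by rewrite rsE; apply: graph_cat.
suff tsE : t ++ s = y' ++ q.
  exists (cone (r ++ s) (t ++ s)); split; first exact: cone_neq0.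
    by apply: cone_le; apply: graph_cat.
  by apply: cone_le; rewrite tsE.
apply: wcat_injl => // w1.
have /fg/induced_graph[a [b [w2 [gab [e1 e2]]]]] :
    induced f1 (wcat (r ++ s) w1, wcat (t ++ s) w1).
  apply/induced_graph; exists (r ++ s), (t ++ s), w1; split=> //.
  by apply: xf; apply: graph_cat.
rewrite e2; have [le|/ltnW le] := leqP (size a) (size (r ++ s)).
  have [d rsd ->] := wcat_prefix (esym e1) le.
  rewrite -wcatA; congr (wcat _ w1); apply: (graph_functional _ grs).
  by rewrite rsd; apply: graph_cat.
have [d ad ->] := wcat_prefix e1 le.
rewrite -wcatA; congr (wcat _ w2); apply: (graph_functional gab).
by rewrite ad; apply: graph_cat.
Qed.

Lemma pfun_pi n (f : M n) : 1 < n -> pfun (\pi_(Cn n) f) = induced f.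
Proof.
move=> n1; apply/(M_equivP _ _ n1)/asboolP.
by apply/(@eqquotP _ (M_equiv_rel n) (Cn n)); rewrite reprK.
Qed.

Lemma pfun_inj n : 1 < n -> injective (@pfun n).
Proof.
move=> n1 c d /(M_equivP _ _ n1)/asboolP cd.
rewrite -(reprK c) -(reprK d).
exact/(@eqquotP _ (M_equiv_rel n) (Cn n)).
Qed.

(* Main.v *)
Require Import Defs.
From HB Require Import structures.
From mathcomp Require Import all_boot.
From mathcomp Require Import mathcomp_extra boolp classical_sets.
Local Open Scope classical_set_scope.

Set Implicit Arguments.
Unset Strict Implicit.
Unset Printing Implicit Defensive.

(** Both operations lift to [M n] by prescribing graphs: [f rho_a] is
    [{(u, t) | f (a u, t)}] and the union of the [f_a rho_a^-1] is
    [{(a u, t) | f_a (u, t)}].  Finite generation of the image of a morphism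
    comes for free, the images of generators of the domain being generators.
    Since [pfun] is injective, the two axioms become identities between graphs
    on infinite strings, where they hold because every infinite string starts
    with exactly one letter. *)

(** The set in [code_form], for a list under no condition: first components may repeat or be
    prefixes of one another, and functionality is asked for where it matters. *)
Definition span_graph (n : nat) (c : seq (seq 'I_n * seq 'I_n)) :
    set (word n * word n) :=
  [set uv | exists x y s, (x, y) \in c /\ uv = (x ++ s, y ++ s)].

Lemma fg_right_ideal_span (n : nat) (G : seq (seq 'I_n)) :
  fg_right_ideal [set u : word n | exists g s, g \in G /\ u = g ++ s].
Proof.
split; last by exists G.
by move=> _ s [g [s' [gG ->]]]; exists g, (s' ++ s); rewrite catA.
Qed.

Lemma span_graph_in_M (n : nat) (c : seq (seq 'I_n * seq 'I_n)) :
  functional (span_graph c) -> in_M (span_graph c).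
Proof.
(* The right disjunct also covers an empty [c], both ideals then being generated by the empty
   list. *)
move=> fc; right.
exists [set u : word n | exists g s, g \in map fst c /\ u = g ++ s],
  [set u : word n | exists g s, g \in map snd c /\ u = g ++ s].
split; [exact: fg_right_ideal_span|exact: fg_right_ideal_span|split=> //].
- apply/seteqP; split=> [u [v [x [y [s [xyc [-> _]]]]]]|].
    by exists x, s; split=> //; apply/mapP; exists (x, y).
  by move=> _ [_ [s [/mapP[[x y] xyc ->] ->]]]; exists (y ++ s), x, y, s.
- apply/seteqP; split=> [v [u [x [y [s [xyc [_ ->]]]]]]|].
    by exists y, s; split=> //; apply/mapP; exists (x, y).
  by move=> _ [_ [s [/mapP[[x y] xyc ->] ->]]]; exists (x ++ s), x, y, s.
- move=> _ _ s [x [y [s' [xyc [-> ->]]]]].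
  by exists x, y, (s' ++ s); rewrite !catA.
Qed.

Lemma graph_span (n : nat) (f : M n) : exists c, graph f = span_graph c.
Proof. by have [c [_ _ fE]] := code_formP f; exists c. Qed.

Definition lquot_graph (n : nat) (a : 'I_n) (f : set (word n * word n)) :
    set (word n * word n) :=
  [set uv | f (a :: uv.1, uv.2)].

(* An empty generator [x] of the domain is first refined to the word [a]. *)
Definition lquot_code (n : nat) (a : 'I_n) (p : seq 'I_n * seq 'I_n) :
    seq (seq 'I_n * seq 'I_n) :=
  match p.1 with
  | [::] => [:: ([::], rcons p.2 a)]
  | b :: x => if b == a then [:: (x, p.2)] else [::]
  end.

Lemma lquot_graph_span (n : nat) (a : 'I_n) (c : seq (seq 'I_n * seq 'I_n)) :
  lquot_graph a (span_graph c) = span_graph (flatten (map (lquot_code a) c)).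
Proof.
apply/seteqP; split=> [[u v] [x [y [s [xyc [e ->]]]]]|].
  case: x xyc e => [|b x] xyc /= e.
    (* The tail [s] is [a :: u] here; its first letter passes to the end of [y]. *)
    exists [::], (rcons y a), u; rewrite -e cat_rcons; split=> //.
    by apply/flatten_mapP; exists ([::], y) => //; rewrite inE.
  case: e => e ->; exists x, y, s; split=> //.
  apply/flatten_mapP; exists (b :: x, y) => //.
  by rewrite /lquot_code /= e eqxx inE.
move=> _ [x [y [s [/flatten_mapP[[[|b x'] y'] xyc] + ->]]]].
  rewrite inE => /eqP[-> ->]; exists [::], y', (a :: s).
  by rewrite /= cat_rcons.
rewrite /lquot_code /=; case: eqP => // ba; rewrite inE => /eqP[-> ->].
by exists (b :: x'), y', s; rewrite /= ba; split=> //; rewrite -ba.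
Qed.

Lemma lquot_in_M (n : nat) (a : 'I_n) (f : M n) :
  in_M (lquot_graph a (graph f)).
Proof.
have ff : functional (lquot_graph a (graph f)).
  by move=> x y z; apply: graph_functional.
move: ff; have [c ->] := graph_span f.
by rewrite lquot_graph_span; apply: span_graph_in_M.
Qed.

Definition lquot (n : nat) (a : 'I_n) (f : M n) : M n :=
  MkM (lquot_in_M a f).

Definition glue_graph (n : nat) (fs : 'I_n -> set (word n * word n)) :
    set (word n * word n) :=
  [set uv | exists a u, uv.1 = a :: u /\ fs a (u, uv.2)].

Definition glue_code (n : nat) (cs : 'I_n -> seq (seq 'I_n * seq 'I_n)) :
    seq (seq 'I_n * seq 'I_n) :=
  flatten [seq [seq (a :: p.1, p.2) | p <- cs a] | a <- enum 'I_n].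

Lemma glue_graph_span (n : nat) (cs : 'I_n -> seq (seq 'I_n * seq 'I_n)) :
  glue_graph (fun a => span_graph (cs a)) = span_graph (glue_code cs).
Proof.
apply/seteqP; split=> [[_ v] [a [u [/= -> [x [y [s [xyc [-> ->]]]]]]]]|].
  exists (a :: x), y, s; split=> //; apply/flatten_mapP.
  by exists a; [rewrite mem_enum|apply/mapP; exists (x, y)].
move=> _ [_ [_ [s [/flatten_mapP[a _ /mapP[[x y] xyc [-> ->]]] ->]]]].
by exists a, (x ++ s); split=> //; exists x, y, s.
Qed.

Lemma glue_in_M (n : nat) (fs : 'I_n -> M n) :
  in_M (glue_graph (fun a => graph (fs a))).
Proof.
(* The first letter of the argument tells which [fs a] applies, so the union stays functional. *)
have ff : functional (glue_graph (fun a => graph (fs a))).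
  move=> x y z [a [u [/= -> fy]]] [b [v [/= [ab uv] fz]]].
  by rewrite -ab -uv in fz; apply: graph_functional fy fz.
have [cs csE] := choice (fun a => graph_span (fs a)).
move: ff; rewrite (_ : (fun a => graph (fs a)) = fun a => span_graph (cs a)).
  by rewrite glue_graph_span; apply: span_graph_in_M.
exact/funext.
Qed.

Definition glue (n : nat) (fs : 'I_n -> M n) : M n := MkM (glue_in_M fs).

Lemma induced_lquot (n : nat) (a : 'I_n) (f : M n) :
  induced (lquot a f) = comp_graph (induced f) (rho a).
Proof.
apply/seteqP; split=> [[u v] /induced_graph[x [y [w [fxy [-> ->]]]]]|].
  exists (wcat [:: a] (wcat x w)); split=> //; rewrite -wcatA.
  by apply/induced_graph; exists (a :: x), y, w.
move=> [u v] [t [tu /induced_graph[x [y [w [fxy [e ->]]]]]]].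
rewrite /rho /= in tu; rewrite {}tu in e.
apply/induced_graph; case: x fxy e => [|b x] fxy e.
  (* For empty [x], the string [w] is [a] followed by [u]; extending the pair by [a] puts the empty
     word into the domain of [lquot a f]. *)
  exists [::], (y ++ [:: a]), u; split; first exact: (graph_cat [:: a] fxy).
  (* Prepending the empty word is the identity, by [wcat_mkseq] at length 0. *)
  congr pair; first by rewrite -[LHS](wcat_mkseq u 0).
  rewrite wcatA e; congr (wcat y _).
  by rewrite -[LHS](wcat_mkseq w 0).
have [s [ba xs] uE] := wcat_prefix e (isT : size [:: a] <= size (b :: x)).
exists s, y, w; split; last by rewrite uE.
by move: fxy; rewrite ba xs.
Qed.

Lemma induced_glue (n : nat) (fs : 'I_n -> M n) :
  induced (glue fs) =
    \bigcup_(a in [set: 'I_n]) comp_graph (induced (fs a)) (inv_graph (rho a)).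
Proof.
apply/seteqP; split=> [[u v] /induced_graph[x [y [w [fxy [-> ->]]]]]|].
  case: fxy => a [t [/= -> ft]]; exists a => //.
  exists (wcat t w); split; first by rewrite /inv_graph /rho /= -wcatA.
  by apply/induced_graph; exists t, y, w.
move=> [u v] [a _ [t [+ /induced_graph[x [y [w [fxy [tE ->]]]]]]]].
rewrite /inv_graph /rho /= tE -wcatA => ->.
by apply/induced_graph; exists (a :: x), y, w; split=> //; exists a, x.
Qed.

(** [rho a] after its inverse is the identity on the strings that start with [a], and over all
    letters these sets cover the whole space. *)
Lemma bigcup_rho_inv (n : nat) (F : set (omega n * omega n)) :
  \bigcup_(a in [set: 'I_n])
    comp_graph (comp_graph F (rho a)) (inv_graph (rho a)) = F.
Proof.
apply/seteqP; split=> [[u v] [a _ [t [+ [z [+ Fzv]]]]]|[u v] Fuv].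
  by rewrite /inv_graph /rho /= => -> <-.
exists (u 0) => //; exists (fun k => u k.+1).
have uE : u = wcat [:: u 0] (fun k => u k.+1) by rewrite -[LHS](wcat_mkseq u 1).
by split; [exact: uE|exists u; split].
Qed.

(** Every value of [rho a] starts with [a], so only the member [b = a] of the union applies to it,
    and there the inverse undoes [rho a]. *)
Lemma bigcup_inv_rho (n : nat) (F : 'I_n -> set (omega n * omega n))
    (a : 'I_n) :
  comp_graph
    (\bigcup_(b in [set: 'I_n]) comp_graph (F b) (inv_graph (rho b))) (rho a) =
  F a.
Proof.
apply/seteqP; split=> [[u v] [z [+ [b _ [t [+ Fv]]]]]|[u v] Fuv].
  rewrite /inv_graph /rho /= => -> e.
  have [s sE uE] := wcat_prefix e (isT : size [:: a] <= size [:: b]).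
  (* Comparing two words of length one gives [b = a] and an empty [s], whence [u] is [t]. *)
  case: sE uE Fv => -> <- ->; rewrite /=.
  by rewrite -[X in F a (X, _) -> _](wcat_mkseq t 0).
by exists (wcat [:: a] u); split=> //; exists a => //; exists u.
Qed.

Theorem theorem5p19 (n : nat) (hn : (1 < n)%N) :
  exists (alpha : 'I_n -> Cn n -> Cn n) (lambda : ('I_n -> Cn n) -> Cn n),
    [/\ forall fs : 'I_n -> Cn n,
          pfun (lambda fs) =
            \bigcup_(i in [set: 'I_n]) comp_graph (pfun (fs i)) (inv_graph (rho i)),
        forall (i : 'I_n) (f : Cn n),
          pfun (alpha i f) = comp_graph (pfun f) (rho i)
      & cantor_algebra alpha lambda].
Proof.
(* Working on chosen representatives needs no compatibility check: [pfun] of a class is by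
   definition induced by its representative. *)
pose alpha (i : 'I_n) (f : Cn n) : Cn n := (\pi_(Cn n) (lquot i (repr f)))%qT.
pose lambda (fs : 'I_n -> Cn n) : Cn n :=
  (\pi_(Cn n) (glue (fun i => repr (fs i))))%qT.
have lambdaE fs : pfun (lambda fs) = \bigcup_(i in [set: 'I_n])
    comp_graph (pfun (fs i)) (inv_graph (rho i)).
  by rewrite /lambda pfun_pi// induced_glue.
have alphaE i f : pfun (alpha i f) = comp_graph (pfun f) (rho i).
  by rewrite /alpha pfun_pi// induced_lquot.
exists alpha, lambda; split=> //; split=> [f|fs i]; apply: pfun_inj => //.
  rewrite lambdaE -[RHS]bigcup_rho_inv.
  by apply: eq_bigcupr => i _; rewrite alphaE.
by rewrite alphaE lambdaE bigcup_inv_rho.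
Qed.
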